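(* Let $(\mathcal{R},\leq)$ be a Strassen preordered commutative semiring with asymptotic spectrum $\mathcal{X}$. For a function $F\colon\mathcal{R}\to\mathbb{R}_{\geq0}$ the following are equivalent: (i) $F$ is monotone, subadditive, submultiplicative, and monomially homogeneous; (ii) there exists a nonempty closed subset $\mathcal{Z}\subseteq\mathcal{X}$ such that $F(a)=\max_{\phi\in\mathcal{Z}}\phi(a)$ for all $a\in\mathcal{R}$. Moreover, in (ii) one can take $\mathcal{Z}=\{\phi\in\mathcal{X}:\phi(a)\leq F(a)\text{ for all }a\in\mathcal{R}\}$.
   Context: $\mathcal{R}$ is a commutative semiring with $0$ and $1$; a natural number $n$ denotes $1+\cdots+1\in\mathcal{R}$. A preorder $\leq$ on $\mathcal{R}$ is a Strassen preorder if $0\leq a$ for all $a$; $a\leq b$ implies $a+c\leq b+c$ and $ac\leq bc$; for every nonzero $a$ there is $n\in\mathbb{N}$ with $1\leq a\leq n$; and for $n,m\in\mathbb{N}$, $n\leq m$ in $\mathcal{R}$ iff $n\leq m$ in $\mathbb{N}$. The asymptotic spectrum $\mathcal{X}$ is the set of maps $\phi\colon\mathcal{R}\to\mathbb{R}_{\geq0}$ with $\phi(1)=1$, $\phi(a+b)=\phi(a)+\phi(b)$, $\phi(ab)=\phi(a)\phi(b)$, and $a\leq b\Rightarrow\phi(a)\leq\phi(b)$; it carries the topology of pointwise convergence (the weakest topology making each evaluation $\phi\mapsto\phi(a)$ continuous), in which it is compact Hausdorff. $F$ is monotone if $a\leq b\Rightarrow F(a)\leq F(b)$; subadditive if $F(a+b)\leq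 F(a)+F(b)$; submultiplicative if $F(ab)\leq F(a)F(b)$; monomially homogeneous if $F(ma^n)=mF(a)^n$ for all $m,n\in\mathbb{N}$ and $a\in\mathcal{R}$. *)

(* Defs.v *)
From HB Require Import structures.
From mathcomp Require Import all_boot all_order all_algebra.
From mathcomp Require Import all_classical all_reals all_analysis.

Set Implicit Arguments.
Unset Strict Implicit.
Unset Printing Implicit Defensive.

Import Order.TTheory GRing.Theory Num.Theory.
Import numFieldNormedType.Exports.

Local Open Scope classical_set_scope.
Local Open Scope ring_scope.

Record Strassen_preorder (S : comPzSemiRingType) (le : S -> S -> Prop) : Prop :=
  StrassenPreorder {
    Strassen_refl : forall a, le a a;
    Strassen_trans : forall a b c, le a b -> le b c -> le a c;
    Strassen_ge0 : forall a, le 0 a;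
    Strassen_add : forall a b c, le a b -> le (a + c) (b + c);
    Strassen_mul : forall a b c, le a b -> le (a * c) (b * c);
    Strassen_bounded : forall a, a <> 0 ->
      exists n : nat, le 1 a /\ le a n%:R;
    Strassen_nat : forall n m : nat, le n%:R m%:R <-> (n <= m)%N
  }.

Section AsymptoticSpectrum.
Context (R : realType) (S : comPzSemiRingType) (le : S -> S -> Prop).

Definition monotone_for (F : S -> R) : Prop :=
  forall a b, le a b -> F a <= F b.

Definition subadditive_fun (F : S -> R) : Prop :=
  forall a b, F (a + b) <= F a + F b.

Definition submultiplicative_fun (F : S -> R) : Prop :=
  forall a b, F (a * b) <= F a * F b.

Definition monomially_homogeneous (F : S -> R) : Prop :=
  forall (m n : nat) (a : S), F (m%:R * a ^+ n) = m%:R * F a ^+ n.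

(* As a type, this set carries the library's subtype topology, that is, the
   one induced by the topology of pointwise convergence on S -> R. *)
Definition asymptotic_spectrum : set {ptws S -> R} :=
  [set phi : S -> R | [/\ forall a, 0 <= phi a,
     phi 1 = 1,
     forall a b, phi (a + b) = phi a + phi b,
     forall a b, phi (a * b) = phi a * phi b &
     monotone_for phi]].

Definition pointwise_max (F : S -> R) (Z : set asymptotic_spectrum) : Prop :=
  forall a, [set set_val phi a | phi in Z] (F a) /\
            ubound [set set_val phi a | phi in Z] (F a).

Definition spectrum_below (F : S -> R) : set asymptotic_spectrum :=
  [set phi | forall a, set_val phi a <= F a].

End AsymptoticSpectrum.

Arguments asymptotic_spectrum R {S} le.
Arguments spectrum_below {R S} le F.

(* Main.v *)
(** Call a function satisfying (i) a gauge. If [F] is a gauge and [F b > 0],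
    the functions [x |-> F (x b^n) / F b^n] decrease to a gauge [F_b <= F] with
    [F_b (b x) >= F b * F_b x]. By Zorn, take [G] minimal among the gauges below
    [F] that agree with [F] at [a]. Minimality gives [G_a = G], so
    [G (a x) = G a * G x] for all [x]; hence [G_b a = G a] for every [b], so
    [G_b] is again a competitor, [G_b = G], and [G] is multiplicative. A
    multiplicative gauge is additive, by the binomial theorem, so [G] is a point
    of the spectrum below [F] attaining [F a]. *)

Require Import Defs.
From HB Require Import structures.
From mathcomp Require Import all_boot all_order all_algebra.
From mathcomp Require Import all_classical all_reals all_analysis.
From mathcomp Require Import lra.

Set Implicit Arguments.
Unset Strict Implicit.
Unset Printing Implicit Defensive.

Import Order.TTheory GRing.Theory Num.Theory.
Import numFieldNormedType.Exports.

Local Open Scope classical_set_scope.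
Local Open Scope ring_scope.

(** * Elementary real inequalities *)

Lemma bernoulli (R : realDomainType) (e : R) (n : nat) :
  0 <= e -> 1 + n%:R * e <= (1 + e) ^+ n.
Proof.
move=> e_ge0; elim: n => [|n IHn]; first by rewrite expr0 mul0r addr0.
rewrite exprS -natr1; apply: (@le_trans _ _ ((1 + e) * (1 + n%:R * e))).
  have : 0 <= n%:R * e ^+ 2 by rewrite mulr_ge0 ?ler0n ?exprn_ge0.
  by nra.
by rewrite ler_wpM2l // addr_ge0.
Qed.

(** If [a > w > 0], the powers of [a / w] outgrow every linear function, as squaring Bernoulli's
    inequality already shows. *)
Lemma le_of_exp_le_linear (R : archiRealFieldType) (a w : R) :
  0 <= w -> (forall n, a ^+ n <= n.+1%:R * w ^+ n) -> a <= w.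
Proof.
move=> w_ge0 aw; rewrite leNgt; apply/negP => lt_wa.
have [w0|w_neq0] := eqVneq w 0.
  by have := aw 1%N; rewrite w0 !expr1 mulr0 => a_le0; lra.
have w_gt0 : 0 < w by rewrite lt_def w_neq0.
pose e := a / w - 1.
have e_gt0 : 0 < e by rewrite subr_gt0 ltr_pdivlMr // mul1r.
have tn n : (1 + e) ^+ n <= n.+1%:R.
  rewrite /e [1 + _]addrC subrK expr_div_n ler_pdivrMr ?exprn_gt0 //.
(* Such an [n] has [(n * e) ^ 2 > 2 * n], so [(1 + n * e) ^ 2] exceeds the bound [2 * n + 1] that
   [tn] gives at exponent [2 * n]. *)
have [n n_gt] : exists n : nat, 2 / e ^+ 2 < n%:R.
  by exists (Num.Def.truncn (2 / e ^+ 2)).+1; exact: truncnS_gt.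
have n_gt0 : 0 < (n%:R : R).
  by apply: le_lt_trans n_gt; rewrite divr_ge0 // exprn_ge0 // ltW.
move: n_gt; rewrite ltr_pdivrMr ?exprn_gt0 // => n_gt.
have := tn (2 * n)%N; rewrite mulnC exprM -natr1 natrM => t2.
have b := bernoulli n (ltW e_gt0).
have n_ge0 : 0 <= n%:R * e by rewrite mulr_ge0 ?ler0n ?ltW.
have : (1 + n%:R * e) ^+ 2 <= ((1 + e) ^+ n) ^+ 2.
  by rewrite lerXn2r // nnegrE ?exprn_ge0; lra.
by nra.
Qed.

(** * Infima of families of real functions *)

Section PointwiseInfimum.
Context (R : realType) (T : Type).
Implicit Types (D : set (T -> R)).

Definition pointwise_inf D (x : T) : R := inf [set f x | f in D].

Lemma pointwise_inf_le D f x :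
  (forall g y, D g -> 0 <= g y) -> D f -> pointwise_inf D x <= f x.
Proof.
move=> D_ge0 Df; apply: ge_inf; last by exists f.
by exists 0 => _ [g Dg <-]; exact: D_ge0.
Qed.

Lemma le_pointwise_inf D c x :
  D !=set0 -> (forall f, D f -> c <= f x) -> c <= pointwise_inf D x.
Proof.
move=> [g Dg] cD; apply: lb_le_inf; first by exists (g x), g.
by move=> _ [f Df <-]; exact: cD.
Qed.

(** This and the next lemma let a sum or a product of two infima be bounded one infimum at a
    time. *)
Lemma le_add_pointwise_inf D c k x :
  D !=set0 -> (forall f, D f -> c <= k + f x) -> c <= k + pointwise_inf D x.
Proof.
move=> D0 cD; rewrite -lerBlDl; apply: le_pointwise_inf => // f Df.
by rewrite lerBlDl cD.
Qed.

Lemma le_mul_pointwise_inf D c k x : D !=set0 -> 0 <= k ->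
  (forall f, D f -> c <= k * f x) -> c <= k * pointwise_inf D x.
Proof.
move=> D0 k_ge0 cD; have [k0|k_neq0] := eqVneq k 0.
  by have [f /cD] := D0; rewrite k0 !mul0r.
have k_gt0 : 0 < k by rewrite lt_def k_neq0.
rewrite mulrC -ler_pdivrMr //; apply: le_pointwise_inf => // f Df.
by rewrite ler_pdivrMr // mulrC cD.
Qed.

End PointwiseInfimum.

(** * Gauges and their infima *)

Section Gauge.
Context (R : realType) (S : comPzSemiRingType) (le : S -> S -> Prop).
Context (le_Strassen : Strassen_preorder le).
Implicit Types (F G : S -> R) (a b x y : S).

Definition gauge F : Prop :=
  [/\ monotone_for le F, subadditive_fun F, submultiplicative_fun F &
       monomially_homogeneous F].

Lemma gauge_monotone F : gauge F -> monotone_for le F.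
Proof. by case. Qed.

Lemma gaugeD F : gauge F -> subadditive_fun F.
Proof. by case. Qed.

Lemma gaugeM F : gauge F -> submultiplicative_fun F.
Proof. by case. Qed.

Lemma gaugeX F x n : gauge F -> F (x ^+ n) = F x ^+ n.
Proof. by case=> _ _ _ /(_ 1%N n x); rewrite !mul1r. Qed.

Lemma gauge_natM F m x : gauge F -> F (m%:R * x) = m%:R * F x.
Proof. by case=> _ _ _ /(_ m 1%N x); rewrite !expr1. Qed.

Lemma gauge1 F : gauge F -> F 1 = 1.
Proof. by move=> gF; rewrite -(expr0 0) gaugeX. Qed.

Lemma gauge0 F : gauge F -> F 0 = 0.
Proof. by move=> gF; have := gauge_natM 0 0 gF; rewrite !mul0r. Qed.

Lemma gauge_ge0 F x : gauge F -> 0 <= F x.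
Proof.
move=> gF; rewrite -(gauge0 gF); apply: gauge_monotone => //.
exact: (Strassen_ge0 le_Strassen).
Qed.

Lemma gauge_gt0 F x : gauge F -> x <> 0 -> 0 < F x.
Proof.
move=> gF /(Strassen_bounded le_Strassen)[n [x1 _]].
by apply: lt_le_trans (gauge_monotone gF x1); rewrite gauge1.
Qed.

(** Serves both for the shifts of a gauge and for chains of gauges. Shifts need not be
    submultiplicative, so the last two hypotheses allow passing to another member of [D], which the
    infimum does not notice. Directedness replaces two members by a common lower one. *)
Lemma gauge_pointwise_inf (D : set (S -> R)) :
  D !=set0 ->
  (forall f g, D f -> D g ->
     exists h, [/\ D h, forall x, h x <= f x & forall x, h x <= g x]) ->
  (forall f, D f -> [/\ monotone_for le f, subadditive_fun f, f 1 = 1 &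
     forall m x, f (m%:R * x) = m%:R * f x]) ->
  (forall f, D f -> exists g, D g /\ forall x y, g (x * y) <= f x * f y) ->
  (forall f n, D f -> exists g, D g /\ forall x, g x ^+ n <= f (x ^+ n)) ->
  gauge (pointwise_inf D).
Proof.
move=> D0 Ddir Dprop Dmul Dexp.
have D_ge0 f x : D f -> 0 <= f x.
  move=> Df; have [fmono _ _ fnat] := Dprop _ Df.
  have f0 : f 0 = 0 by have := fnat 0 0; rewrite !mul0r.
  by rewrite -f0; apply: fmono; exact: (Strassen_ge0 le_Strassen).
have inf_le f x : D f -> pointwise_inf D x <= f x.
  by move=> Df; exact: pointwise_inf_le.
have inf_ge0 x : 0 <= pointwise_inf D x.
  by apply: le_pointwise_inf => // f; exact: D_ge0.
have inf1 : pointwise_inf D 1 <= 1.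
  have [f Df] := D0; have [_ _ <- _] := Dprop _ Df; exact: inf_le.
have infM : submultiplicative_fun (pointwise_inf D).
  move=> x y; apply: le_mul_pointwise_inf => // f Df.
  rewrite [leRHS]mulrC; apply: le_mul_pointwise_inf => // [|g Dg]; first exact: D_ge0.
  have [h [Dh hf hg]] := Ddir _ _ Df Dg.
  have [k [Dk kh]] := Dmul _ Dh.
  apply: le_trans (inf_le _ _ Dk) _; apply: le_trans (kh _ _) _.
  by rewrite [leRHS]mulrC ler_pM // D_ge0.
have infX x n : pointwise_inf D (x ^+ n) = pointwise_inf D x ^+ n.
  apply/eqP; rewrite eq_le; apply/andP; split.
    (* This half follows from submultiplicativity, with [inf1] as base case; the other half is
       [Dexp]. *)
    elim: n => [|n IHn]; first by rewrite !expr0.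
    by rewrite !exprS; apply: le_trans (infM _ _) _; rewrite ler_wpM2l.
  apply: le_pointwise_inf => // f Df; have [g [Dg gf]] := Dexp _ n Df.
  by apply: le_trans (gf x); apply: lerXn2r; rewrite ?nnegrE ?inf_le //; exact: D_ge0.
have inf_natM m x : pointwise_inf D (m%:R * x) = m%:R * pointwise_inf D x.
  apply/eqP; rewrite eq_le; apply/andP; split.
    apply: le_mul_pointwise_inf => // f Df; have [_ _ _ <-] := Dprop _ Df.
    exact: inf_le.
  apply: le_pointwise_inf => // f Df; have [_ _ _ ->] := Dprop _ Df.
  by rewrite ler_wpM2l // inf_le.
split=> //.
- move=> x y xy; apply: le_pointwise_inf => // f Df.
  have [fmono _ _ _] := Dprop _ Df.
  by apply: le_trans (fmono _ _ xy); exact: inf_le.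
- move=> x y; apply: le_add_pointwise_inf => // f Df.
  rewrite [leRHS]addrC; apply: le_add_pointwise_inf => // g Dg.
  have [h [Dh hf hg]] := Ddir _ _ Df Dg.
  have [_ hadd _ _] := Dprop _ Dh.
  apply: le_trans (inf_le _ _ Dh) _; apply: le_trans (hadd _ _) _.
  by rewrite [leRHS]addrC lerD.
- by move=> m n x; rewrite inf_natM infX.
Qed.

(** * Shifts and stabilization *)

Definition shift F b (n : nat) x : R := F (x * b ^+ n) / F b ^+ n.

(** Submultiplicativity splits off [b ^+ k]. The shifts thus decrease with the index, so they form a
    directed family. *)
Lemma shift_addn F b n k x : gauge F -> 0 < F b ->
  shift F b (n + k) x <= shift F b n x.
Proof.
move=> gF Fb; rewrite /shift ler_pdivrMr ?exprn_gt0 //.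
rewrite exprD mulrA exprD mulrA divfK ?gt_eqF ?exprn_gt0 //.
by rewrite -(gaugeX _ _ gF) gaugeM.
Qed.

(** If [F] is the maximum over a closed set of characters, this is the maximum over those that
    attain [F b] at [b]. *)
Definition stabilization F b : S -> R := pointwise_inf (range (shift F b)).

Lemma gauge_stabilization F b : gauge F -> 0 < F b -> gauge (stabilization F b).
Proof.
move=> gF Fb; have Fbn n : 0 < F b ^+ n by rewrite exprn_gt0.
apply: gauge_pointwise_inf.
- by exists (shift F b 0), 0%N.
- move=> _ _ [n _ <-] [k _ <-]; exists (shift F b (n + k)).
  split; [by exists (n + k)%N | by move=> x; exact: shift_addn|].
  by move=> x; rewrite addnC; exact: shift_addn.
- move=> _ [n _ <-]; split; rewrite /shift.
  + move=> x y xy; rewrite ler_pM2r ?invr_gt0 //.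
    by apply: (gauge_monotone gF); exact: (Strassen_mul le_Strassen).
  + by move=> x y; rewrite -mulrDl ler_pM2r ?invr_gt0 // mulrDl gaugeD.
  + by rewrite mul1r gaugeX // divff // gt_eqF.
  + by move=> m x; rewrite -mulrA gauge_natM // mulrA.
- move=> _ [n _ <-]; exists (shift F b (n + n)); split; first by exists (n + n)%N.
  move=> x y; rewrite /shift mulrACA -invfM -exprD ler_pM2r ?invr_gt0 //.
  by rewrite exprD mulrACA gaugeM.
- move=> _ k [n _ <-]; exists (shift F b n); split; first by exists n.
  move=> x; rewrite /shift.
  (* For a positive exponent, the power of the shift is itself a shift at [x ^+ k.+1], of index
     [n * k.+1 >= n]. At exponent 0 that index would drop below [n], but both sides are 1. *)
  case: k => [|k]; first by rewrite !expr0 mul1r gaugeX // divff // gt_eqF.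
  rewrite expr_div_n -(gaugeX (x * b ^+ n) k.+1 gF) exprMn.
  have -> : F (x ^+ k.+1 * (b ^+ n) ^+ k.+1) / (F b ^+ n) ^+ k.+1
    = shift F b (n + n * k) (x ^+ k.+1).
    by rewrite /shift -!exprM mulnS.
  exact: shift_addn.
Qed.

Lemma stabilization_le F b x : gauge F -> 0 < F b -> stabilization F b x <= F x.
Proof.
move=> gF Fb; have -> : F x = shift F b 0 x.
  by rewrite /shift !expr0 mulr1 divr1.
apply: pointwise_inf_le; last by exists 0%N.
by move=> _ y [n _ <-]; rewrite divr_ge0 ?exprn_ge0 ?gauge_ge0.
Qed.

(** A factor [b] in the argument raises the index of a shift by one and costs [F b]; the infimum
    lies below the shift of every index. *)
Lemma stabilizationM F b x : gauge F -> 0 < F b ->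
  F b * stabilization F b x <= stabilization F b (b * x).
Proof.
move=> gF Fb; apply: le_pointwise_inf; first by exists (shift F b 0), 0%N.
move=> _ [n _ <-].
have -> : shift F b n (b * x) = F b * shift F b n.+1 x.
  by rewrite /shift !exprS [b * x]mulrC -mulrA invfM [RHS]mulrCA mulVKf // gt_eqF.
rewrite ler_pM2l //; apply: pointwise_inf_le; last by exists n.+1.
by move=> _ y [k _ <-]; rewrite divr_ge0 ?exprn_ge0 ?gauge_ge0.
Qed.

Lemma stabilization_id F a b : gauge F -> 0 < F b ->
  (forall x, F (a * x) = F a * F x) -> stabilization F b a = F a.
Proof.
move=> gF Fb Fa; apply/eqP; rewrite eq_le stabilization_le //=.
apply: le_pointwise_inf; first by exists (shift F b 0), 0%N.
by move=> _ [n _ <-]; rewrite /shift Fa gaugeX // mulfK // gt_eqF ?exprn_gt0.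
Qed.

(* Binomial coefficients times monomials are below [(x + y) ^+ n], so the n-th
   power of [F x + F y] is at most [n + 1] times that of [F (x + y)]. *)
Lemma multiplicative_gaugeD F : gauge F -> (forall x y, F (x * y) = F x * F y) ->
  forall x y, F (x + y) = F x + F y.
Proof.
move=> gF FM x y; apply/eqP; rewrite eq_le gaugeD //=.
apply: le_of_exp_le_linear => [|n]; first exact: gauge_ge0.
(* The right-hand side becomes a sum of [n.+1] equal terms, to be compared termwise with the
   binomial expansion. *)
rewrite exprDn mulr_natl -[n.+1 in leRHS]card_ord -sumr_const.
apply: ler_sum => i _.
rewrite -!gaugeX // -FM -mulr_natl -gauge_natM // mulr_natl.
apply: gauge_monotone => //; rewrite exprDn (bigD1 i) //=.
set z := (_ *+ _); have := Strassen_add le_Strassen z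
  (Strassen_ge0 le_Strassen (\sum_(j < n.+1 | j != i)
     x ^+ (n - j) * y ^+ j *+ 'C(n, j))).
by rewrite add0r addrC.
Qed.

(** * Minimal gauges and characters *)

Lemma exists_minimal_gauge F a : gauge F ->
  exists G, [/\ gauge G, forall x, G x <= F x, G a = F a &
    forall H, gauge H -> (forall x, H x <= G x) -> H a = F a -> H = G].
Proof.
move=> gF.
pose P G := [/\ gauge G, forall x, G x <= F x & G a = F a].
have PF : P F by [].
(* The order is reversed, so that a maximal element for Zorn's lemma is a minimal gauge. *)
pose r (G H : {G | P G}) := `[< forall x, sval H x <= sval G x >].
have [||A Atot|G Gmax] := @ZL_preorder {G | P G} (exist _ F PF) r.
- by move=> G; apply/asboolP.
- move=> G H K /asboolP HG /asboolP KH; apply/asboolP => x.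
  exact: le_trans (KH x) (HG x).
- have [A0|/set0P[G0 AG0]] := eqVneq A set0.
    by exists (exist _ F PF) => G; rewrite A0.
  pose D := [set sval G | G in A].
  have D0 : D !=set0 by exists (sval G0), G0.
  have Psval f : D f -> P f by move=> [G _ <-]; exact: svalP G.
  have gD f : D f -> gauge f by move=> /Psval[].
  have DG0 : D (sval G0) by exists G0.
  have D_ge0 f x : D f -> 0 <= f x by move=> /gD; exact: gauge_ge0.
  (* The infimum of a nonempty chain bounds it: totality gives directedness, and each member, being
     a gauge, is its own witness for the other conditions. *)
  have PD : P (pointwise_inf D).
    split.
    + apply: gauge_pointwise_inf => //.
      * move=> _ _ [f Af <-] [g Ag <-].
        by case: (Atot _ _ Af Ag) => /asboolP fg; [exists (sval g)|exists (sval f)];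
          split=> //; [exists g|exists f].
      * move=> f /gD gf; split; [exact: gauge_monotone|exact: gaugeD|
          exact: gauge1|by move=> m x; exact: gauge_natM].
      * by move=> f Df; exists f; split=> //; exact: gaugeM (gD _ Df).
      * by move=> f n Df; exists f; split=> // x; rewrite gaugeX //; exact: gD.
    + move=> x; apply: le_trans (pointwise_inf_le x D_ge0 DG0) _.
      by have [_ + _] := Psval _ DG0; exact.
    + apply/eqP; rewrite eq_le; apply/andP; split.
        by have [_ _ <-] := Psval _ DG0; exact: pointwise_inf_le.
      by apply: le_pointwise_inf => // f /Psval[_ _ ->].
  exists (exist _ _ PD) => G AG; apply/asboolP => x /=.
  by apply: pointwise_inf_le => //; exists G.
- have [gG GF Ga] := svalP G; exists (sval G); split=> // H gH HG Ha.
  have PH : P H by split=> // x; apply: le_trans (HG x) (GF x).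
  apply/funext => x; apply/eqP; rewrite eq_le HG /=.
  (* Maximality in a preorder only returns the opposite comparison; antisymmetry holds pointwise. *)
  have /asboolP GH : r (exist _ H PH) G by apply: Gmax; apply/asboolP.
  exact: GH.
Qed.

Lemma exists_character_below F a : gauge F -> 0 < F a ->
  exists phi : S -> R, [/\ asymptotic_spectrum R le phi,
    forall x, phi x <= F x & phi a = F a].
Proof.
move=> gF Fa; have [G [gG GF GaF Gmin]] := exists_minimal_gauge a gF.
have Ga : 0 < G a by rewrite GaF.
have stab_mul b : 0 < G b -> stabilization G b a = G a ->
    forall x, G (b * x) = G b * G x.
  move=> Gb stab_a x; have stabE : stabilization G b = G.
    apply: Gmin; [exact: gauge_stabilization| |by rewrite stab_a].
    by move=> y; exact: stabilization_le.
  apply/eqP; rewrite eq_le gaugeM //=.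
  by have := stabilizationM x gG Gb; rewrite stabE.
have GaM : forall x, G (a * x) = G a * G x.
  apply: stab_mul => //; apply/eqP; rewrite eq_le stabilization_le //=.
  (* At the argument 1 this reads [G a <= stabilization G a a]. *)
  have := stabilizationM 1 gG Ga.
  by rewrite (gauge1 (gauge_stabilization gG Ga)) !mulr1.
have GM x y : G (x * y) = G x * G y.
  have [->|/(gauge_gt0 gG) Gx] := pselect (x = 0).
    by rewrite mul0r gauge0 // mul0r.
  by apply: stab_mul => //; exact: stabilization_id.
exists G; split=> //; split=> //.
- by move=> x; exact: gauge_ge0.
- exact: gauge1.
- exact: multiplicative_gaugeD.
- exact: gauge_monotone.
Qed.

(** * Maxima over sets of characters *)

Lemma gauge_of_pointwise_max F (Z : set (asymptotic_spectrum R le)) :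
  pointwise_max F Z -> gauge F.
Proof.
move=> FZ.
have char (phi : asymptotic_spectrum R le) :
    asymptotic_spectrum R le (set_val phi) by exact: set_valP.
have FZub phi x : Z phi -> set_val phi x <= F x.
  by move=> Zphi; apply: (FZ x).2; exists phi.
split.
(* Each inequality is checked at a character attaining the maximum on its left-hand side. *)
- move=> x y xy; have [[phi Zphi <-] _] := FZ x.
  have [_ _ _ _ mono] := char phi.
  exact: le_trans (mono _ _ xy) (FZub _ _ Zphi).
- move=> x y; have [[phi Zphi <-] _] := FZ (x + y).
  by have [_ _ -> _ _] := char phi; rewrite lerD ?FZub.
- move=> x y; have [[phi Zphi <-] _] := FZ (x * y).
  by have [ge0 _ _ -> _] := char phi; rewrite ler_pM ?FZub.
- have charE (phi : asymptotic_spectrum R le) m n x :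
      set_val phi (m%:R * x ^+ n) = m%:R * set_val phi x ^+ n.
    have [_ phi1 phiD phiM _] := char phi.
    have phi0 : set_val phi 0 = 0.
      by have := phiD 0 0; rewrite addr0 => ?; lra.
    rewrite phiM; congr (_ * _).
      by elim: m => [|m IHm]; rewrite ?phi0 // -!natr1 phiD IHm phi1.
    by elim: n => [|n IHn]; rewrite ?expr0 // !exprS phiM IHn.
  (* The upper bound uses a maximizer at the monomial, the lower one a maximizer at [x]. *)
  move=> m n x; apply/eqP; rewrite eq_le; apply/andP; split.
    have [[phi Zphi <-] _] := FZ (m%:R * x ^+ n).
    have [ge0 _ _ _ _] := char phi.
    rewrite charE ler_wpM2l // lerXn2r ?FZub // nnegrE //.
    exact: le_trans (ge0 x) (FZub _ _ Zphi).
  by have [[phi Zphi <-] _] := FZ x; rewrite -charE FZub.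
Qed.

Lemma closed_spectrum_below F : closed (spectrum_below le F).
Proof.
have -> : spectrum_below le F =
    \bigcap_(a in setT)
      [set phi : asymptotic_spectrum R le | set_val phi a <= F a].
  by apply/seteqP; split=> [phi phiF a _|phi phiF a]; [exact: phiF|exact: phiF a I].
apply: closed_bigI => a _.
pose eval_a (phi : asymptotic_spectrum R le) : R := set_val phi a.
apply: (@preimage_closed _ R eval_a [set x | x <= F a]); last exact: closed_le.
(* Evaluation is the inclusion of the subtype, continuous for the initial topology, followed by a
   coordinate projection. *)
move=> phi _; apply: (@continuous_comp _ {ptws S -> R} _ set_val (fun f => f a)).
  exact: initial_continuous.
exact: (@proj_continuous S (fun=> R) a).
Qed.

Lemma pointwise_max_spectrum_below F : gauge F ->
  pointwise_max F (spectrum_below le F).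
Proof.
move=> gF a; split; last by move=> _ [phi phiF <-]; exact: phiF.
have below phi : asymptotic_spectrum R le phi -> (forall x, phi x <= F x) ->
    [set set_val psi a | psi in spectrum_below le F] (phi a).
  by move=> Xphi phiF; exists (SigSub (mem_set Xphi)).
(* At 0 the value of [F] is 0, which every character below [F] attains; one such character comes
   from the element 1. *)
have [a0|/(gauge_gt0 gF) Fa] := pselect (a = 0); last first.
  have [phi [Xphi phiF <-]] := exists_character_below gF Fa; exact: below.
have F1 : 0 < F 1 by rewrite gauge1.
have [phi [Xphi phiF _]] := exists_character_below gF F1.
suff -> : F a = phi a by exact: below.
have [ge0 _ _ _ _] := Xphi.
by apply/eqP; rewrite eq_le phiF a0 gauge0 // ge0.
Qed.

End Gauge.

Theorem theorem3p2 (R : realType) (S : comPzSemiRingType)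
    (le : S -> S -> Prop) (le_Strassen : Strassen_preorder le)
    (F : S -> R) (F_ge0 : forall a, 0 <= F a) :
  ([/\ monotone_for le F, subadditive_fun F, submultiplicative_fun F &
       monomially_homogeneous F] <->
   exists Z : set (asymptotic_spectrum R le),
     [/\ Z !=set0, closed Z & pointwise_max F Z]) /\
  ((exists Z : set (asymptotic_spectrum R le),
     [/\ Z !=set0, closed Z & pointwise_max F Z]) ->
   [/\ spectrum_below le F !=set0, closed (spectrum_below le F) &
       pointwise_max F (spectrum_below le F)]).
Proof.
have below_gauge : gauge le F ->
    [/\ spectrum_below le F !=set0, closed (spectrum_below le F) &
       pointwise_max F (spectrum_below le F)].
  move=> gF; have maxF := pointwise_max_spectrum_below le_Strassen gF.
  split=> //; last exact: closed_spectrum_below.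
  (* Attainment at a single element, here 0, already exhibits a point of the set. *)
  by have [[phi phiF _] _] := maxF 0; exists phi.
split; first split.
- by move=> gF; exists (spectrum_below le F); exact: below_gauge.
- by move=> [Z [_ _ /gauge_of_pointwise_max]].
- by move=> [Z [_ _ /gauge_of_pointwise_max]]; exact: below_gauge.
Qed.
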